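(* Suppose (A1) $f(x)\to+\infty$ as $|x|\to\infty$; (A4) $f$ and $g$ are twice continuously differentiable on $\mathbb{R}^n$; and $\nabla g(x)\neq 0$ for all $x\in\mathbb{R}^n$ (so in particular (A3): $\nabla g\ne 0$ on $\Omega$). Let $x_0\in\Omega$ with $\nabla f(x_0)\neq0$ and $\zeta\in[0,1)$. Then the trajectory $x(t;\zeta,x_0)$ converges, as $t\to T_{\zeta,x_0}^-$, to a connected subset of the set of critical points of $f$: there is a connected set $K\subset\{x:\nabla f(x)=0\}$ such that $\mathrm{dist}(x(t;\zeta,x_0),K)\to0$ as $t\to T_{\zeta,x_0}^-$. In particular, if the critical points of $f$ are isolated, then for every $\zeta\in[0,1)$ $$\lim_{t\to T_{\zeta,x_0}^-}x(t;\zeta,x_0)=x_c$$ for some critical point $x_c$ of $f$.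
   Context: Let $f,g:\mathbb{R}^n\to\mathbb{R}$ and let $\Omega=\{x\in\mathbb{R}^n: g(x)\le 0\}$ be the feasible set. $|\cdot|$ is the Euclidean norm. For $\zeta\in[0,1)$ define, wherever $\nabla f\ne0$ and $\nabla g\neq 0$, the vector field $\mathbf{s}_\zeta=-\frac{\nabla f}{|\nabla f|}-\zeta\frac{\nabla g}{|\nabla g|}$. For an initial point $x_0\in\Omega$, $x(t;\zeta,x_0)$ denotes the solution of $\frac{dx}{dt}=\mathbf{s}_\zeta(x)$, $x|_{t=0}=x_0$, and $[0,T_{\zeta,x_0})$ is its maximal forward interval of existence in the whole $\mathbb{R}^n$ (not restricted to $\Omega$; the trajectory terminates upon reaching a point where $\nabla f=0$, so $T_{\zeta,x_0}$ may be finite or infinite). *)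

(* Defs.v *)
From HB Require Import structures.
From mathcomp Require Import all_boot all_order all_algebra.
From mathcomp Require Import all_classical all_reals all_analysis.

Set Implicit Arguments.
Unset Strict Implicit.
Unset Printing Implicit Defensive.

Import Order.TTheory GRing.Theory Num.Theory.
Import numFieldNormedType.Exports.

Local Open Scope classical_set_scope.
Local Open Scope ring_scope.

(* R^n is 'rV[R]_n. Its library norm is the sup norm, which induces the same
   topology; metric notions below use the Euclidean norm instead. *)
Definition enorm (R : realType) (n : nat) (v : 'rV[R]_n) : R :=
  Num.sqrt (\sum_(i < n) v 0 i ^+ 2).

(* Pitfall: this is 0 when K is empty. *)
Definition eucl_dist (R : realType) (n : nat) (p : 'rV[R]_n) (K : set 'rV[R]_n) : R :=
  inf [set enorm (p - q) | q in K].

Definition grad (R : realType) (n : nat) (f : 'rV[R]_n -> R) (p : 'rV[R]_n) :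
    'rV[R]_n :=
  \row_(i < n) 'D_(delta_mx 0 i) f p.

Definition crit (R : realType) (n : nat) (f : 'rV[R]_n -> R) : set 'rV[R]_n :=
  [set p | grad f p = 0].

(* In finite dimension, continuity of p |-> 'd f p in operator norm is
   continuity of p |-> 'd f p v for every fixed v. *)
Definition cont_diff (R : realType) (n : nat) (f : 'rV[R]_n -> R) : Prop :=
  (forall p, differentiable f p) /\
  (forall v : 'rV[R]_n, continuous (fun p => 'D_v f p)).

Definition cont_diff2 (R : realType) (n : nat) (f : 'rV[R]_n -> R) : Prop :=
  cont_diff f /\ (forall v : 'rV[R]_n, cont_diff (fun p => 'D_v f p)).

Definition coercive (R : realType) (n : nat) (f : 'rV[R]_n -> R) : Prop :=
  forall M : R, exists r : R, forall p, r < enorm p -> M < f p.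

Definition feasible (R : realType) (n : nat) (g : 'rV[R]_n -> R) :
    set 'rV[R]_n :=
  [set p | g p <= 0].

(* Meaningful only where both gradients are nonzero (elsewhere 0^-1 = 0). *)
Definition sfield (R : realType) (n : nat) (f g : 'rV[R]_n -> R) (zeta : R)
    (p : 'rV[R]_n) : 'rV[R]_n :=
  - ((enorm (grad f p))^-1 *: grad f p)
  - zeta *: ((enorm (grad g p))^-1 *: grad g p).

(* Solution of dx/dt = sfield x, x(0) = x0 on [0, T), staying in the region
   where the field is defined. Only the values of x on [0, T) matter, so at
   t = 0 the derivative is the right one. *)
Definition is_solution (R : realType) (n : nat) (f g : 'rV[R]_n -> R) (zeta : R)
    (x0 : 'rV[R]_n) (T : \bar R) (x : R -> 'rV[R]_n) : Prop :=
  [/\ (0 < T)%E,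
      x 0 = x0,
      (forall t : R, 0 <= t -> (t%:E < T)%E ->
         grad f (x t) != 0 /\ grad g (x t) != 0),
      h^-1 *: (x h - x 0) @[h --> 0^'+] --> sfield f g zeta (x 0) &
      (forall t : R, 0 < t -> (t%:E < T)%E ->
         is_derive t (1 : R) x (sfield f g zeta (x t)))].

Definition is_max_solution (R : realType) (n : nat) (f g : 'rV[R]_n -> R)
    (zeta : R) (x0 : 'rV[R]_n) (T : \bar R) (x : R -> 'rV[R]_n) : Prop :=
  is_solution f g zeta x0 T x /\
  (forall (T' : \bar R) (y : R -> 'rV[R]_n),
     is_solution f g zeta x0 T' y -> (T <= T')%E ->
     (forall t : R, 0 <= t -> (t%:E < T)%E -> y t = x t) ->
     T' = T).

(* The filter t -> T^-, for T in ]-oo, +oo]; the -oo branch is never used, as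
   solutions have T > 0. *)
Definition left_of (R : realType) (T : \bar R) : set_system R :=
  match T with
  | r%:E => r^'-
  | +oo%E => pinfty_nbhs R
  | -oo%E => ninfty_nbhs R
  end.

(* Main.v *)
Require Import Defs.
From HB Require Import structures.
From mathcomp Require Import all_boot all_order all_algebra.
From mathcomp Require Import all_classical all_reals all_analysis.
From mathcomp Require Import ring lra.
Import Order.TTheory GRing.Theory Num.Theory.
Import numFieldNormedType.Exports.
Local Open Scope classical_set_scope.
Local Open Scope ring_scope.

(** Along a trajectory, the derivative of f is the inner product of s_zeta with
    the gradient of f, and by Cauchy-Schwarz it is at most
    - (1 - zeta) |grad f| ([sfield_descent]). Hence f decreases along the
    trajectory, coercivity confines the trajectory to a compact set, and its
    omega-limit set K (the cluster set of x along t -> T) is nonempty and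
    attracts x. K is connected because tails of the trajectory are connected
    and eventually enter every open set containing K ([connected_cluster]).
    It remains to see that the points of K are critical.

    If T is infinite, let p in K with grad f p nonzero. The field has norm at
    most 2, so each time the trajectory comes close to p it stays for a fixed
    time in a ball where |grad f| is bounded below, and f drops by a fixed
    amount. A visit sufficiently close to p would then take f below f p,
    whereas f >= f p along the whole trajectory
    ([omega_limit_crit_infinite]).

    If T is finite, the trajectory is Lipschitz, so it has a limit p at T. If
    grad f p were nonzero, s_zeta would be Lipschitz near p: gradients of C^2
    functions are locally Lipschitz, and so are square roots and inverses away
    from 0 ([loc_lipschitz_sfield]). The Picard-Lindelof theorem
    ([picard_lindelof]), obtained from a contraction argument for the uniform
    distance, then provides a solution starting from p, and gluing it to x
    contradicts the maximality of T ([maximal_limit_crit]).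

    When the critical points are isolated, the connected set K is a single
    point, and attraction to K is convergence to that point. *)

(** * Calculus of curves in R^n *)

Lemma row_norm_leP {R : realType} {n : nat} (v : 'rV[R]_n) (M : R) : 0 <= M ->
  `|v| <= M <-> forall i, `|v 0 i| <= M.
Proof.
move=> M0; rewrite [`|v|]/Num.Def.normr/= mx_normrE; split=> [vM i|vM].
  by apply: le_trans vM; exact: (le_bigmax _ (fun ij => `|v ij.1 ij.2|) (0, i)).
by apply: bigmax_le => // -[i j] _ /=; rewrite (ord1 i).
Qed.

Lemma row_coord_le {R : realType} {n : nat} (v : 'rV[R]_n) (i : 'I_n) :
  `|v 0 i| <= `|v|.
Proof. by move: i; apply/row_norm_leP. Qed.

Lemma is_derive_rowP {R : realType} {n : nat} (y : R -> 'rV[R]_n) (t : R)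
    (d : 'rV[R]_n) :
  is_derive t (1 : R) y d <->
  forall i, is_derive t (1 : R) (fun u => y u 0 i) (d 0 i).
Proof.
split=> [[dy yd] i|H].
  split; first by have /derivable_mxP := dy; exact.
  by rewrite -yd derive_mx// mxE.
have dy : derivable y t 1.
  by apply/derivable_mxP => i j; rewrite (ord1 i);
    exact: (@ex_derive _ _ _ _ _ _ _ (H j)).
split=> //; rewrite derive_mx//; apply/matrixP => i j; rewrite mxE (ord1 i).
exact: (@derive_val _ _ _ _ _ _ _ (H j)).
Qed.

Lemma is_derive_continuous {R : realType} {V : normedModType R} (y : R -> V)
    (t : R) (d : V) : is_derive t (1 : R) y d -> {for t, continuous y}.
Proof. by move=> [dy _]; apply/differentiable_continuous/derivable1_diffP. Qed.

Lemma lipschitz_continuous {R : realType} {V W : normedModType R} (f : V -> W)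
    (L : R) : (forall s t, `|f s - f t| <= L * `|s - t|) -> continuous f.
Proof.
move=> fL t; apply/cvgrPdist_le => e e0; near=> s.
apply: le_trans (fL _ _) _.
have L1 : 0 < `|L| + 1 by have := normr_ge0 L; lra.
have st : `|t - s| <= e / (`|L| + 1).
  near: s; apply: cvgr_dist_le; last by rewrite divr_gt0.
  exact: cvg_id.
apply: (@le_trans _ _ ((`|L| + 1) * `|t - s|));
  last by rewrite mulrC -ler_pdivlMr.
by apply: ler_wpM2r => //; have := ler_norm L; lra.
Unshelve. all: by end_near. Qed.

Lemma mean_value_le {R : realType} (h dh : R -> R) (a b M : R) : a <= b ->
  (forall t, a < t < b -> is_derive t (1 : R) h (dh t)) ->
  {within `[a, b], continuous h} ->
  (forall t, a < t < b -> dh t <= M) -> h b - h a <= M * (b - a).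
Proof.
move=> + dhE hc hM; rewrite le_eqVlt => /predU1P[->|ab].
  by rewrite !subrr mulr0.
have dhI t : t \in `]a, b[ -> is_derive t (1 : R) h (dh t).
  by rewrite in_itv/=; exact: dhE.
have [c cab ->] := MVT ab dhI hc.
by apply: ler_wpM2r; [rewrite subr_ge0 ltW|apply: hM; rewrite in_itv/= in cab].
Qed.

(** Holds with the same constant as in dimension one because the norm on rows
    is the sup norm: the scalar mean value theorem applies to each
    coordinate. *)
Lemma mean_value_norm_le {R : realType} {n : nat} (y dy : R -> 'rV[R]_n)
    (a b M : R) : 0 <= M -> a <= b ->
  (forall t, a <= t <= b -> is_derive t (1 : R) y (dy t)) ->
  (forall t, a <= t <= b -> `|dy t| <= M) -> `|y b - y a| <= M * (b - a).
Proof.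
move=> M0 ab dyE dyM; apply/row_norm_leP => [|i];
  first by rewrite mulr_ge0 ?subr_ge0.
have dyi t : a <= t <= b -> is_derive t (1 : R) (fun u => y u 0 i) (dy t 0 i).
  by move=> /dyE /is_derive_rowP.
have ci : {within `[a, b], continuous (fun u => y u 0 i)}.
  by apply: derivable_within_continuous => t; rewrite in_itv/= => /dyi[].
have W t : a < t < b -> a <= t <= b by case/andP => /ltW -> /ltW ->.
rewrite !mxE ler_norml; apply/andP; split; last first.
  apply: (@mean_value_le _ (fun u => y u 0 i) (fun u => dy u 0 i)) => // t /W
    tab; first exact: dyi.
  by rewrite (le_trans (ler_norm _))// (le_trans (row_coord_le _ _))// dyM.
rewrite lerNl opprB -[leLHS]opprK opprB.
have -> : - (y b 0 i - y a 0 i) = - y b 0 i - - y a 0 i by ring.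
apply: (@mean_value_le _ (fun u => - y u 0 i) (fun u => - dy u 0 i)) => //.
- by move=> t /W tab; apply: is_deriveN; exact: dyi.
- by move=> t; apply: continuousN; exact: ci.
- move=> t /W tab.
  by rewrite (le_trans (ler_norm _))// normrN (le_trans (row_coord_le _ _))//
    dyM.
Qed.

(** The lower bound - a leaves room on the left of 0, so that the primitive is
    differentiable on both sides of an initial time 0. *)
Definition row_primitive {R : realType} {n : nat} (a : R) (h : R -> 'rV[R]_n)
    (t : R) : 'rV[R]_n :=
  \row_i \int[lebesgue_measure]_(u in `[- a, t]) h u 0 i.

Lemma row_primitiveP {R : realType} {n : nat} (a : R) (h : R -> 'rV[R]_n)
    (t : R) :
  continuous h -> - a < t < a ->
  is_derive t (1 : R) (row_primitive a h) (h t).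
Proof.
move=> hc /andP[at_ ta]; apply/is_derive_rowP => i.
have hic : continuous (fun u => h u 0 i).
  move=> u.
  apply: (@continuous_comp _ _ _ h (fun v : 'rV[R]_n => v 0 i) u (hc u)).
  exact: coord_continuous.
have [||d1 d2] :=
  @continuous_FTC1_closed R (fun u => h u 0 i) (- a) t a ta _ at_.
- apply: continuous_compact_integrable; first exact: segment_compact.
  exact: continuous_subspaceT.
- exact: hic.
have -> : (fun u => row_primitive a h u 0 i) =
  (fun x0 => \int[lebesgue_measure]_(t in `[- a, x0]) h t 0 i).
  by apply/funext => u; rewrite mxE.
by apply: DeriveDef; [exact: d1|rewrite -derive1E; exact: d2].
Qed.

(** * Fixed points for the uniform distance *)

(** Banach's fixed point theorem for the uniform distance on functions T -> V,
    restricted to a class P closed under uniform limits. The iterates stay at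
    distance 2 M from w0, and the contraction turns this into the Cauchy bound
    2 M / 2 ^ k between the iterates of rank at least k. *)
Lemma uniform_fixed_point {R : realType} {T : Type}
    {V : completeNormedModType R}
    (P : (T -> V) -> Prop) (Phi : (T -> V) -> T -> V) (w0 : T -> V) (M : R) :
  P w0 -> (forall w, P w -> P (Phi w)) ->
  (forall w, (forall e, 0 < e ->
     exists2 w', P w' & forall t, `|w t - w' t| <= e) -> P w) ->
  (forall w w' c, P w -> P w' -> (forall t, `|w t - w' t| <= c) ->
     forall t, `|Phi w t - Phi w' t| <= c / 2) ->
  (forall t, `|Phi w0 t - w0 t| <= M) ->
  exists2 w, P w & forall t, Phi w t = w t.
Proof.
move=> P0 PPhi Pcl ctr M0; pose u k := iter k Phi w0.
have Pu k : P (u k) by elim: k => //= k; exact: PPhi.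
have uw0 m t : `|u m t - w0 t| <= 2 * M.
  elim: m t => [|m IH] t.
    by have := le_trans (normr_ge0 _) (M0 t); rewrite /u/= subrr normr0; lra.
  rewrite -(subrKA (Phi w0 t)) (le_trans (ler_normD _ _))//.
  have := ctr _ _ _ (Pu m) P0 IH t; have := M0 t; rewrite /u /=; lra.
have u_cauchy k m t : `|u (m + k)%N t - u k t| <= 2 * M / 2 ^+ k.
  elim: k m t => [|k IH] m t; first by rewrite expr0 divr1 addn0; exact: uw0.
  have := ctr _ _ _ (Pu _) (Pu k) (IH m) t.
  by rewrite addnS exprSr invfM mulrA.
have small (e : R) : 0 < e -> exists k, 2 * M / 2 ^+ k <= e.
  move=> e0; have : (geometric (2 * M) (2^-1 : R)) @ \oo --> (0:R).
    by apply: cvg_geometric; rewrite ger0_norm ?invr_ge0//; lra.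
  move=> /cvgrPdist_le/(_ e e0)[k _ /(_ k (leqnn k))];
    rewrite sub0r normrN/= => H.
  by exists k; rewrite -exprVn (le_trans (ler_norm _)).
have ucv t : cvgn (fun k => u k t).
  apply/cauchy_cvgP/cauchy_exP => e e0.
  have [k ke] := small (e / 2) ltac:(lra).
  exists (u k t); exists k => // m /= km; rewrite -ball_normE/= distrC.
  by rewrite -(subnK km) (le_lt_trans (u_cauchy _ _ _))//; lra.
pose w t := limn (fun k => u k t).
have uw k t : `|w t - u k t| <= 2 * M / 2 ^+ k.
  apply/ler_addgt0Pl => e e0.
  have /cvgrPdist_le/(_ e e0)[m _ /(_ (m + k)%N (leq_addr _ _)) H] := ucv t.
  by rewrite -(subrKA (u (m + k)%N t)) (le_trans (ler_normD _ _))// lerD.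
have Pw : P w.
  by apply: Pcl => e /small[k ke]; exists (u k) => // t; exact: le_trans ke.
exists w => // t; apply/eqP; rewrite -subr_eq0 -normr_le0;
  apply/ler_addgt0Pl => e e0.
have [k ke] := small (e / 2) ltac:(lra).
have wk s : `|w s - u k s| <= e / 2 by exact: le_trans ke.
have wkS : `|w t - u k.+1 t| <= e / 2.
  apply: le_trans (uw _ _) _; apply: le_trans ke; rewrite exprSr invfM mulrA.
  by have := le_trans (normr_ge0 _) (uw k t); lra.
(* Phi w is close to Phi (u k) = u k.+1, which is close to w. *)
rewrite -(subrKA (u k.+1 t)) (le_trans (ler_normD _ _))//.
have := ctr _ _ _ Pw (Pu k) wk t; rewrite distrC in wkS; move: wkS;
  rewrite /u /=; lra.
Qed.

(** * Local existence of solutions *)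

(** Joins the completeness and the norm of matrices, so that
    [uniform_fixed_point] applies to curves in R^n. *)
HB.instance Definition _ (R : realType) (m n : nat) :=
  Uniform_isComplete.Build 'M[R]_(m, n) (@cauchy_cvg _).

Lemma lipschitz_of_derive {R : realType} {n : nat} (y dy : R -> 'rV[R]_n)
    (e M : R) : 0 <= M ->
  (forall t, `|t| <= e -> is_derive t (1 : R) y (dy t)) ->
  (forall t, `|t| <= e -> `|dy t| <= M) ->
  forall s t, `|s| <= e -> `|t| <= e -> `|y s - y t| <= M * `|s - t|.
Proof.
move=> M0 dyE dyM s t; wlog st : s t / t <= s => [H|se te].
  have [|/ltW ts] := leP t s; first exact: H.
  by move=> se te; rewrite distrC (distrC s); exact: H.
have W u : t <= u <= s -> `|u| <= e by move: se te; rewrite !ler_norml; lra.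
rewrite (ger0_norm (_ : 0 <= s - t)) ?subr_ge0//.
by apply: (@mean_value_norm_le _ _ y dy) => // u /W; [exact: dyE|exact: dyM].
Qed.

(** Retraction of the line onto [- e, e]; it makes the Picard operator act on
    functions defined on the whole line, without restricting domains. *)
Definition clamp {R : realType} (e t : R) : R :=
  if t <= - e then - e else if e <= t then e else t.

Lemma clamp_le {R : realType} (e t : R) : 0 <= e -> `|clamp e t| <= e.
Proof.
by move=> e0; rewrite ler_norml /clamp; case: (leP t) => ?;
  [|case: (leP e t) => ?]; lra.
Qed.

Lemma clamp_id {R : realType} (e t : R) : `|t| < e -> clamp e t = t.
Proof.
by rewrite ltr_norml /clamp; case: (leP t) => ?; [|case: (leP e t) => ?]; lra.
Qed.

Lemma clamp_lipschitz {R : realType} (e s t : R) : 0 <= e ->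
  `|clamp e s - clamp e t| <= `|s - t|.
Proof.
move=> e0; wlog st : s t / t <= s => [H|].
  have [|/ltW ts] := leP t s; first exact: H.
  by rewrite distrC (distrC s); exact: H.
rewrite (ger0_norm (_ : 0 <= s - t)) ?subr_ge0// ler_norml /clamp.
by case: (leP s (- e)) => ?; [|case: (leP e s) => ?];
  (case: (leP t (- e)) => ?; [|case: (leP e t) => ?]); lra.
Qed.

(** The Picard operator w |-> p + int_0^t F (w u) du, frozen outside [- e, e],
    preserves the continuous curves with values in the closed ball, and it
    contracts by 1/2. This dictates the choice of e: B e <= r, where B bounds F
    on the ball, and L e <= 1/2. *)
Theorem picard_lindelof {R : realType} {n : nat} (F : 'rV[R]_n -> 'rV[R]_n)
    (p : 'rV[R]_n) (r L : R) : 0 < r -> 0 <= L ->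
  (forall q q', `|q - p| <= r -> `|q' - p| <= r ->
     `|F q - F q'| <= L * `|q - q'|) ->
  exists2 e, 0 < e & exists2 z : R -> 'rV[R]_n, z 0 = p &
    forall t, `|t| < e -> `|z t - p| <= r /\ is_derive t (1 : R) z (F (z t)).
Proof.
move=> r0 L0 FL.
pose B := `|F p| + L * r.
have B0 : 0 <= B by rewrite addr_ge0// mulr_ge0// ltW.
have FB q : `|q - p| <= r -> `|F q| <= B.
  move=> qp; rewrite -[F q](subrK (F p)) (le_trans (ler_normD _ _))// addrC
    lerD2l.
  by rewrite (le_trans (FL _ _ _ _))// ?subrr ?normr0 ?ler_wpM2l// ltW.
have [e [e0 eB eL]] : exists e, [/\ 0 < e, B * e <= r & L * e <= 1 / 2].
  exists (Num.min (r / (B + 1)) (1 / 2 / (L + 1))); split.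
  - by rewrite lt_min !divr_gt0//; lra.
  - apply: (@le_trans _ _ ((B + 1) * (r / (B + 1))));
    last by rewrite mulrC divfK//; lra.
    by apply: ler_pM; rewrite ?le_min ?divr_ge0 ?ge_min ?lexx//; lra.
  - apply: (@le_trans _ _ ((L + 1) * (1 / 2 / (L + 1))));
    last by rewrite mulrC divfK//; lra.
    by apply: ler_pM; rewrite ?le_min ?divr_ge0 ?ge_min ?lexx ?orbT//; lra.
(* With e + 1 in place of e, t = - e and t = e are interior points. *)
pose I (w : R -> 'rV[R]_n) := row_primitive (e + 1) (F \o w).
pose Phi w t := p + (I w (clamp e t) - I w 0).
pose P (w : R -> 'rV[R]_n) := continuous w /\ forall t, `|w t - p| <= r.
have clampe t : `|clamp e t| <= e by apply: clamp_le; exact: ltW.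
have abs0 : `|0 : R| <= e by rewrite normr0 ltW.
have Fwc w : P w -> continuous (F \o w).
  move=> [wc wp] t; apply/cvgrPdist_le => d d0; near=> s.
  apply: (le_trans (FL _ _ (wp _) (wp _))).
  apply: (@le_trans _ _ ((L + 1) * `|w t - w s|));
    first by rewrite ler_wpM2r//; lra.
  rewrite mulrC -ler_pdivlMr; last lra.
  near: s; apply: cvgr_dist_le; first exact: wc.
  by rewrite divr_gt0//; lra.
have dI w : P w -> forall t, `|t| <= e -> is_derive t (1 : R) (I w) (F (w t)).
  move=> Pw t te; apply: (@row_primitiveP _ _ _ (F \o w)); first exact: Fwc.
  by move: te; rewrite ler_norml; lra.
have IB w : P w -> forall s t, `|s| <= e -> `|t| <= e ->
    `|I w s - I w t| <= B * `|s - t|.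
  move=> Pw; apply: (@lipschitz_of_derive _ _ (I w) (F \o w)) => //;
    first exact: dI.
  by move=> t _; apply: FB; exact: Pw.2.
have PPhi w : P w -> P (Phi w).
  move=> Pw; split.
    apply: (@lipschitz_continuous _ _ _ _ B) => s t.
    have -> : Phi w s - Phi w t = I w (clamp e s) - I w (clamp e t).
      by rewrite /Phi opprD addrACA subrr add0r opprB addrA subrK.
    by apply: le_trans (IB _ Pw _ _ _ _) _ => //;
      rewrite ler_wpM2l// clamp_lipschitz// ltW.
  move=> t; rewrite /Phi addrAC subrr add0r.
  apply: le_trans (IB _ Pw _ _ (clampe t) abs0) _.
  by rewrite subr0; apply: le_trans eB; rewrite ler_wpM2l.
have [|||||w Pw wE] := @uniform_fixed_point R R 'rV[R]_n P Phi (cst p) r.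
- by split=> [|t]; [exact: cst_continuous|rewrite subrr normr0 ltW].
- exact: PPhi.
- move=> w wP; split=> [t|t]; last first.
    apply/ler_addgt0Pl => d d0; have [w' [_ w'p] ww'] := wP _ d0.
    by rewrite -(subrKA (w' t)) (le_trans (ler_normD _ _))// lerD.
  apply/cvgrPdist_le => d d0.
  have [w' [w'c _] ww'] := wP (d / 3) ltac:(lra).
  near=> s; rewrite -(subrKA (w' t)) -(subrKA (w' s) (w' t)).
  apply: (@le_trans _ _ (d / 3 + (d / 3 + d / 3))); last lra.
  apply: le_trans (ler_normD _ _) _; apply: lerD => //.
  apply: le_trans (ler_normD _ _) _; apply: lerD; last by rewrite distrC.
  by near: s; apply: cvgr_dist_le; [exact: w'c|lra].
- move=> w w' c Pw Pw' ww' t.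
  have c0 : 0 <= c := le_trans (normr_ge0 _) (ww' 0).
  pose y s := I w s - I w' s.
  have -> : Phi w t - Phi w' t = y (clamp e t) - y 0.
    rewrite /Phi /y opprD addrACA subrr add0r !opprB addrACA [in RHS]addrACA.
    by congr (_ + _); rewrite addrC.
  have H : `|y (clamp e t) - y 0| <= L * c * `|clamp e t - 0|.
    apply: (@lipschitz_of_derive _ _ y (fun s => F (w s) - F (w' s)) e) => //.
    - by rewrite mulr_ge0.
    - by move=> s se; apply: is_deriveB; exact: dI.
    - move=> s _; apply: le_trans (FL _ _ (Pw.2 s) (Pw'.2 s)) _.
      by rewrite ler_wpM2l.
  apply: le_trans H _; rewrite subr0.
  apply: (@le_trans _ _ (L * c * e)); first by rewrite ler_wpM2l// mulr_ge0.
  by rewrite mulrAC -mulrA [c / 2]mulrC mulrA; have := ler_wpM2r c0 eL; lra.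
- move=> t; rewrite /Phi /cst addrAC subrr add0r.
  have Pp : P (cst p).
    by split=> [|s]; [exact: cst_continuous|rewrite subrr normr0 ltW].
  apply: le_trans (IB _ Pp _ _ (clampe t) abs0) _.
  by rewrite subr0; apply: le_trans eB; rewrite ler_wpM2l.
exists e => //; exists w.
  by rewrite -wE /Phi clamp_id ?normr0// subrr addr0.
move=> t te; split; first exact: Pw.2.
have IE : \forall s \near t, p + (I w s - I w 0) = w s.
  near=> s; rewrite -wE /Phi clamp_id//.
  near: s; apply: cvgr_norm_lt te; exact: cvg_id.
apply: (near_eq_is_derive IE).
apply: is_derive_eq.
  apply: is_deriveD; apply: is_deriveB; apply: dI => //; exact: ltW.
by rewrite subr0 add0r.
Unshelve. all: by end_near. Qed.

(** * Locally Lipschitz functions *)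

(** Stated with closed balls of the normed space, which is the form required
    by [picard_lindelof]. *)
Definition loc_lipschitz {R : realType} {V W : normedModType R} (f : V -> W)
    (p : V) : Prop :=
  exists L, exists2 r, 0 < r & forall q q',
    `|q - p| <= r -> `|q' - p| <= r -> `|f q - f q'| <= L * `|q - q'|.

(** Normal form used to combine several functions: the constants are
    nonnegative, a bound for f comes along, and the radius can be shrunk. *)
Lemma loc_lipschitz_bound {R : realType} {V W : normedModType R} (f : V -> W)
    (p : V) : loc_lipschitz f p ->
  exists L B r, [/\ 0 <= L, 0 <= B, 0 < r & forall s, s <= r -> forall q q',
    `|q - p| <= s -> `|q' - p| <= s ->
      `|f q - f q'| <= L * `|q - q'| /\ `|f q| <= B].
Proof.
move=> [L [r r0 fL]]; exists `|L|, (`|f p| + `|L| * r), r; split=> //.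
  by rewrite addr_ge0// mulr_ge0// ltW.
have fL' q q' : `|q - p| <= r -> `|q' - p| <= r ->
    `|f q - f q'| <= `|L| * `|q - q'|.
  by move=> qr q'r; apply: le_trans (fL _ _ qr q'r) _;
    rewrite ler_wpM2r// ler_norm.
move=> s sr q q' qs q's; have qr := le_trans qs sr; have q'r := le_trans q's sr.
split; first exact: fL'.
rewrite -[f q](subrK (f p)) (le_trans (ler_normD _ _))// addrC lerD2l.
by apply: le_trans (fL' _ _ qr _) _; rewrite ?subrr ?normr0 ?ler_wpM2l// ltW.
Qed.

Lemma loc_lipschitz_continuous {R : realType} {V W : normedModType R}
    (f : V -> W) (p : V) :
  loc_lipschitz f p -> {for p, continuous f}.
Proof.
move=> /loc_lipschitz_bound[L [B [r [L0 _ r0 fL]]]].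
have L1 : 0 < L + 1 by lra.
apply/cvgrPdist_le => e e0; near=> q.
have qp : `|p - q| <= Num.min r (e / (L + 1)).
  near: q; apply: cvgr_dist_le; first exact: cvg_id.
  by rewrite lt_min r0 divr_gt0.
move: qp; rewrite le_min => /andP[qr qe].
have [||H _] := fL _ (lexx r) p q.
- by rewrite subrr normr0 ltW.
- by rewrite distrC.
apply: le_trans H _; apply: (@le_trans _ _ ((L + 1) * `|p - q|)).
  by rewrite ler_wpM2r//; lra.
by rewrite mulrC -ler_pdivlMr.
Unshelve. all: by end_near. Qed.

Section loc_lipschitz_theory.
Context {R : realType} {V : normedModType R}.
Implicit Types (f g : V -> R) (p : V).

Lemma loc_lipschitz_cst (c : R) p : loc_lipschitz (cst c : V -> R) p.
Proof. by exists 0; exists 1 => // q q' _ _; rewrite subrr normr0 mul0r. Qed.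

Lemma loc_lipschitzD f g p :
  loc_lipschitz f p -> loc_lipschitz g p ->
  loc_lipschitz (fun q => f q + g q) p.
Proof.
move=> /loc_lipschitz_bound[L [B [r [L0 _ r0 fL]]]].
move=> /loc_lipschitz_bound[M [C [s [M0 _ s0 gM]]]].
exists (L + M); exists (Num.min r s) => [|q q' qp q'p];
  first by rewrite lt_min r0.
have [|f1 _] := fL _ _ _ _ qp q'p; first by rewrite ge_min lexx.
have [|g1 _] := gM _ _ _ _ qp q'p; first by rewrite ge_min lexx orbT.
by rewrite opprD addrACA mulrDl (le_trans (ler_normD _ _))// lerD.
Qed.

Lemma loc_lipschitzM f g p :
  loc_lipschitz f p -> loc_lipschitz g p ->
  loc_lipschitz (fun q => f q * g q) p.
Proof.
move=> /loc_lipschitz_bound[L [B [r [L0 B0 r0 fL]]]].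
move=> /loc_lipschitz_bound[M [C [s [M0 C0 s0 gM]]]].
exists (B * M + L * C); exists (Num.min r s) => [|q q' qp q'p];
  first by rewrite lt_min r0.
have [|f1 fB] := fL _ _ _ _ qp q'p; first by rewrite ge_min lexx.
have [|g1 _] := gM _ _ _ _ qp q'p; first by rewrite ge_min lexx orbT.
have [|_ gC] := gM _ _ _ _ q'p qp; first by rewrite ge_min lexx orbT.
have -> : f q * g q - f q' * g q' =
    f q * (g q - g q') + (f q - f q') * g q' by ring.
rewrite (le_trans (ler_normD _ _))// !normrM mulrDl lerD//.
  by rewrite -mulrA ler_pM.
by rewrite mulrAC ler_pM.
Qed.

Lemma loc_lipschitzN f p :
  loc_lipschitz f p -> loc_lipschitz (fun q => - f q) p.
Proof.
move=> [L [r r0 fL]]; exists L; exists r => // q q' qp q'p.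
by rewrite -opprD normrN; exact: fL.
Qed.

Lemma loc_lipschitz_sum (I : Type) (s : seq I) (F : I -> V -> R) p :
  (forall i, loc_lipschitz (F i) p) ->
  loc_lipschitz (fun q => \sum_(i <- s) F i q) p.
Proof.
move=> Fl; elim: s => [|i s IH].
  by rewrite (_ : (fun q => _) = cst 0); [exact: loc_lipschitz_cst|
    apply/funext => q; rewrite big_nil].
rewrite (_ : (fun q => _) = (fun q => F i q + \sum_(j <- s) F j q)).
  exact: loc_lipschitzD.
by apply/funext => q; rewrite big_cons.
Qed.

Lemma loc_lipschitz_comp (h : R -> R) f p :
  loc_lipschitz h (f p) -> loc_lipschitz f p ->
  loc_lipschitz (fun q => h (f q)) p.
Proof.
move=> /loc_lipschitz_bound[M [C [s [M0 _ s0 hM]]]].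
move=> /loc_lipschitz_bound[L [B [r [L0 _ r0 fL]]]].
have L1 : 0 < L + 1 by lra.
exists (M * L); exists (Num.min r (s / (L + 1))) => [|q q'].
  by rewrite lt_min r0 divr_gt0.
rewrite !le_min => /andP[qr qs] /andP[q'r q's].
have pr : `|p - p| <= r by rewrite subrr normr0 ltW.
have fs u : `|u - p| <= r -> `|u - p| <= s / (L + 1) -> `|f u - f p| <= s.
  move=> ur us; have [H _] := fL _ (lexx r) _ _ ur pr.
  apply: le_trans H _; apply: (@le_trans _ _ ((L + 1) * `|u - p|)).
    by rewrite ler_wpM2r//; lra.
  by rewrite mulrC -ler_pdivlMr.
have [H _] := hM _ (lexx s) _ _ (fs _ qr qs) (fs _ q'r q's).
apply: le_trans H _; rewrite -mulrA ler_wpM2l//.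
by have [] := fL _ (lexx r) _ _ qr q'r.
Qed.

End loc_lipschitz_theory.

Lemma loc_lipschitz_inv {R : realType} (a : R) : 0 < a ->
  loc_lipschitz (fun u : R => u^-1) a.
Proof.
move=> a0; exists ((a / 2)^-1 * (a / 2)^-1); exists (a / 2) => [|u v];
  first lra.
move=> ua va; rewrite ler_norml in ua; rewrite ler_norml in va;
  have u0 : a / 2 <= u by lra.
have v0 : a / 2 <= v by lra.
have -> : u^-1 - v^-1 = u^-1 * v^-1 * (v - u).
  by field; apply/andP; split; apply: lt0r_neq0; lra.
rewrite normrM (distrC v); apply: ler_wpM2r => //.
rewrite normrM !ger0_norm ?invr_ge0; try lra.
by apply: ler_pM; rewrite ?invr_ge0 ?lef_pV2 ?posrE//; lra.
Qed.

(** sqrt u - sqrt v = (u - v) / (sqrt u + sqrt v), and the denominator is at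
    least sqrt (a / 2) near a. *)
Lemma loc_lipschitz_sqrt {R : realType} (a : R) : 0 < a ->
  loc_lipschitz (@Num.sqrt R) a.
Proof.
move=> a0; exists (Num.sqrt (a / 2))^-1; exists (a / 2) => [|u v]; first lra.
move=> ua va; rewrite ler_norml in ua; rewrite ler_norml in va;
  have u0 : a / 2 <= u by lra.
have v0 : a / 2 <= v by lra.
have s0 : 0 < Num.sqrt (a / 2) by rewrite sqrtr_gt0; lra.
have us : Num.sqrt (a / 2) <= Num.sqrt u by rewrite ler_sqrt; lra.
have vs := sqrtr_ge0 v.
rewrite mulrC ler_pdivlMr//.
have -> : u - v = (Num.sqrt u - Num.sqrt v) * (Num.sqrt u + Num.sqrt v).
  by rewrite -subr_sqr !sqr_sqrtr//; lra.
by rewrite normrM ler_wpM2l// ger0_norm; lra.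
Qed.

Lemma loc_lipschitz_row {R : realType} {V : normedModType R} {n : nat}
    (F : V -> 'rV[R]_n) (p : V) :
  (forall i, loc_lipschitz (fun q => F q 0 i) p) -> loc_lipschitz F p.
Proof.
move=> /(_ _)/loc_lipschitz_bound Fl.
have [L HL] := choice Fl.
have [B HB] := choice HL; have [r Hr] := choice HB.
have [s s0 sr] : exists2 s, 0 < s & forall i, s <= r i.
  exists (\big[Num.min/1]_i r i); last by move=> i; exact: bigmin_le.
  by apply/bigmin_gtP; split=> // i _; have [] := Hr i.
have L0 i : 0 <= L i by case: (Hr i).
have S0 : 0 <= \sum_i L i by apply: sumr_ge0.
exists (\sum_i L i); exists s => // q q' qs q's.
apply/row_norm_leP => [|i]; first by rewrite mulr_ge0.
have [_ _ _ /(_ _ (sr i) _ _ qs q's)[H _]] := Hr i.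
rewrite !mxE; apply: le_trans H _; rewrite ler_wpM2r//.
by rewrite (bigD1 i)//= lerDl sumr_ge0.
Qed.

Lemma derive_grad {R : realType} {n : nat} (f : 'rV[R]_n -> R)
    (p v : 'rV[R]_n) :
  differentiable f p -> 'D_v f p = \sum_i v 0 i * grad f p 0 i.
Proof.
move=> df; rewrite deriveE// {1}(row_sum_delta v) linear_sum/=.
by apply: eq_bigr => i _; rewrite linearZ/= mxE deriveE.
Qed.

(** Mean value theorem along the segment from q' to q: the derivative there is
    a combination of the partial derivatives, which continuity bounds near p. *)
Lemma cont_diff_loc_lipschitz {R : realType} {n : nat} (f : 'rV[R]_n -> R)
    (p : 'rV[R]_n) : cont_diff f -> loc_lipschitz f p.
Proof.
move=> [df Dc].
pose C := \sum_i (`|grad f p 0 i| + 1).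
have C0 : 0 <= C by apply: sumr_ge0 => i _; rewrite addr_ge0.
have [r /= r0 rC] : exists2 r, 0 < r &
    forall q, `|p - q| < r -> forall i, `|grad f q 0 i| <= `|grad f p 0 i| + 1.
  suff /nbhs_ballP[r r0 H] :
      \forall q \near p, forall i, `|grad f q 0 i| <= `|grad f p 0 i| + 1.
    by exists r => // q pq; apply: H; rewrite -ball_normE.
  apply: (@filter_forall _ 'I_n
    (fun i q => `|grad f q 0 i| <= `|grad f p 0 i| + 1) (nbhs p)) => i.
  near=> q.
  have H : `|grad f p 0 i - grad f q 0 i| <= 1.
    rewrite !mxE; near: q; apply: cvgr_dist_le => //; exact: Dc.
  rewrite -[X in `|X|](subrK (grad f p 0 i)) (le_trans (ler_normD _ _))// addrC.
  by rewrite lerD2l distrC.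
exists C; exists (r / 2) => [|q q' qr q'r]; first lra.
pose v := q - q'; pose h (t : R) := f (q' + t *: v).
have dh t : is_derive t (1 : R) h ('D_v f (q' + t *: v)).
  have E : (fun k : R => k^-1 *: (h (k *: 1 + t) - h t)) =
           (fun k => k^-1 *: (f (k *: v + (q' + t *: v)) - f (q' + t *: v))).
    by apply/funext => k; rewrite /h scaler1 scalerDl addrCA.
  have dfv : derivable f (q' + t *: v) v by exact: diff_derivable.
  by apply: DeriveDef; rewrite /derivable/derive/= E.
have [c c01] : exists2 c, c \in `]0, 1[ &
    h 1 - h 0 = 'D_v f (q' + c *: v) * (1 - 0).
  apply: (@MVT _ h (fun t => 'D_v f (q' + t *: v))) => //.
  by apply: derivable_within_continuous => t _; case: (dh t).
rewrite /h scale1r scale0r addr0 subr0 mulr1 /v [q' + (q - q')]addrC subrK.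
move=> ->; rewrite -/v derive_grad// (le_trans (ler_norm_sum _ _ _))//.
rewrite /C mulr_suml; apply: ler_sum => i _; rewrite normrM mulrC.
apply: ler_pM => //; last exact: row_coord_le.
apply: rC.
have -> : p - (q' + c *: v) = c *: (p - q) + (1 - c) *: (p - q').
  by rewrite /v; apply/rowP => j; rewrite !mxE; ring.
move: c01; rewrite in_itv/= => /andP[c0 c1].
rewrite (le_lt_trans (ler_normD _ _))// !normrZ !ger0_norm; try lra.
rewrite distrC in qr; rewrite distrC in q'r.
have : c * `|p - q| <= c * (r / 2) by rewrite ler_wpM2l// ltW.
have : (1 - c) * `|p - q'| <= (1 - c) * (r / 2) by rewrite ler_wpM2l//; lra.
lra.
Unshelve. all: by end_near. Qed.

(** * Euclidean norm and the field s_zeta *)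

Section enorm_theory.
Context {R : realType} {n : nat}.
Implicit Types u v : 'rV[R]_n.

Lemma enorm_ge0 v : 0 <= enorm v.
Proof. exact: sqrtr_ge0. Qed.

Lemma sqr_enorm v : enorm v ^+ 2 = \sum_i v 0 i ^+ 2.
Proof. by rewrite sqr_sqrtr//; apply: sumr_ge0 => i _; exact: sqr_ge0. Qed.

Lemma coord_le_enorm v i : `|v 0 i| <= enorm v.
Proof.
rewrite -(ler_pXn2r (n := 2))// ?nnegrE ?enorm_ge0// sqr_enorm (bigD1 i)//=.
by rewrite -normrX ger0_norm ?sqr_ge0// lerDl sumr_ge0// => j _; exact: sqr_ge0.
Qed.

Lemma norm_le_enorm v : `|v| <= enorm v.
Proof.
by apply/row_norm_leP => [|i]; [exact: enorm_ge0|exact: coord_le_enorm].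
Qed.

Lemma enorm_gt0 v : v != 0 -> 0 < enorm v.
Proof.
by move=> v0; apply: lt_le_trans (norm_le_enorm v); rewrite normr_gt0.
Qed.

Lemma enorm0 : enorm (0 : 'rV[R]_n) = 0.
Proof. by rewrite /enorm big1 ?sqrtr0// => i _; rewrite mxE expr0n. Qed.

Lemma enorm_continuous : continuous (@enorm R n).
Proof.
move=> v; apply: (@continuous_comp _ _ _
  (fun u : 'rV[R]_n => \sum_i u 0 i ^+ 2) Num.sqrt).
  move: v; apply: continuous_big => [|i _ v]; first exact: add_continuous.
  by apply: continuousM => /=; exact: (@coord_continuous R 1 n 0 i v).
exact: sqrt_continuous.
Qed.

(** The side of the Cauchy-Schwarz inequality needed below; it comes from
    0 <= | |v| u + |u| v |^2. *)
Lemma dot_ge u v : - (enorm u * enorm v) <= \sum_i u 0 i * v 0 i.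
Proof.
have [->|u0] := eqVneq u 0.
  by rewrite enorm0 mul0r oppr0 big1// => i _; rewrite mxE mul0r.
have [->|v0] := eqVneq v 0.
  by rewrite enorm0 mulr0 oppr0 big1// => i _; rewrite mxE mulr0.
have a0 := enorm_gt0 _ u0; have b0 := enorm_gt0 _ v0.
set a := enorm u; set b := enorm v.
have : 0 <= \sum_i (b * u 0 i + a * v 0 i) ^+ 2.
  by apply: sumr_ge0 => i _; exact: sqr_ge0.
have -> : \sum_i (b * u 0 i + a * v 0 i) ^+ 2 =
    b ^+ 2 * (\sum_i u 0 i ^+ 2) + (2 * a * b) * (\sum_i u 0 i * v 0 i) +
    a ^+ 2 * (\sum_i v 0 i ^+ 2).
  by rewrite !mulr_sumr -!big_split/=; apply: eq_bigr => i _; ring.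
rewrite -!sqr_enorm -/a -/b.
set s := \sum_i _; have -> : b ^+ 2 * a ^+ 2 + 2 * a * b * s + a ^+ 2 * b ^+ 2 =
  2 * a * b * (a * b + s) by ring.
by rewrite pmulr_rge0 ?mulr_gt0//; lra.
Qed.

Lemma coord_normalize_le v i : `|(enorm v)^-1 * v 0 i| <= 1.
Proof.
rewrite normrM ger0_norm ?invr_ge0 ?enorm_ge0//.
have [v0|v0] := eqVneq (enorm v) 0; first by rewrite v0 invr0 mul0r.
rewrite mulrC ler_pdivrMr ?mul1r ?coord_le_enorm//.
by rewrite lt_neqAle eq_sym v0 enorm_ge0.
Qed.

End enorm_theory.

Section sfield_theory.
Context {R : realType} {n : nat} {f g : 'rV[R]_n -> R} {zeta : R}.

Lemma sfieldE p i : sfield f g zeta p 0 i =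
  - ((enorm (grad f p))^-1 * grad f p 0 i)
  - zeta * ((enorm (grad g p))^-1 * grad g p 0 i).
Proof. by rewrite /sfield !mxE. Qed.

Lemma norm_sfield_le p : 0 <= zeta <= 1 -> `|sfield f g zeta p| <= 2.
Proof.
move=> /andP[z0 z1]; apply/row_norm_leP => // i; rewrite sfieldE.
have := coord_normalize_le (grad f p) i;
  have := coord_normalize_le (grad g p) i.
set b := _ * _; set a := _ * _ => b1 a1.
rewrite (le_trans (ler_normB _ _))// normrN (normrM zeta) (ger0_norm z0).
have : zeta * `|b| <= 1 * 1 by apply: ler_pM.
lra.
Qed.

(** The component of s_zeta along grad g can undo at most the fraction zeta of
    the decrease of f produced by - grad f / |grad f|. *)
Lemma sfield_descent p : 0 <= zeta -> grad f p != 0 -> grad g p != 0 ->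
  \sum_i sfield f g zeta p 0 i * grad f p 0 i <=
    - ((1 - zeta) * enorm (grad f p)).
Proof.
move=> z0 /enorm_gt0 a0 /enorm_gt0 b0.
under eq_bigr do rewrite sfieldE.
set a := enorm (grad f p); set b := enorm (grad g p).
have -> :
    \sum_i (- (a^-1 * grad f p 0 i) - zeta * (b^-1 * grad g p 0 i))
      * grad f p 0 i =
    - a^-1 * (\sum_i grad f p 0 i ^+ 2)
      - zeta * (b^-1 * \sum_i grad g p 0 i * grad f p 0 i).
  rewrite !mulr_sumr -sumrN -big_split/=; apply: eq_bigr => i _; ring.
rewrite -sqr_enorm -/a; have := dot_ge (grad g p) (grad f p); rewrite -/a -/b.
set s := \sum_i _ => hs.
have -> : - a^-1 * a ^+ 2 = - a by field; exact: lt0r_neq0.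
have : - a <= b^-1 * s by rewrite mulrC ler_pdivlMr// mulNr mulrC.
move=> /(ler_wpM2l z0); lra.
Qed.

Hypotheses (f2 : cont_diff2 f) (g2 : cont_diff2 g).

Lemma loc_lipschitz_grad (h : 'rV[R]_n -> R) p i : cont_diff2 h ->
  loc_lipschitz (fun q => grad h q 0 i) p.
Proof.
move=> [_ h2]; rewrite (_ : (fun q => _) = (fun q => 'D_(delta_mx 0 i) h q)).
  exact: cont_diff_loc_lipschitz.
by apply/funext => q; rewrite mxE.
Qed.

Lemma loc_lipschitz_enorm_grad (h : 'rV[R]_n -> R) p : cont_diff2 h ->
  grad h p != 0 -> loc_lipschitz (fun q => enorm (grad h q)) p.
Proof.
move=> h2 hp; apply: (@loc_lipschitz_comp _ _ Num.sqrt
  (fun q => \sum_i grad h q 0 i ^+ 2)).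
  apply: loc_lipschitz_sqrt; rewrite -sqr_enorm exprn_gt0//; exact: enorm_gt0.
apply: loc_lipschitz_sum => i.
by apply: loc_lipschitzM; exact: loc_lipschitz_grad.
Qed.

Lemma loc_lipschitz_normalized_grad (h : 'rV[R]_n -> R) p i : cont_diff2 h ->
  grad h p != 0 ->
  loc_lipschitz (fun q => (enorm (grad h q))^-1 * grad h q 0 i) p.
Proof.
move=> h2 hp; apply: loc_lipschitzM; last exact: loc_lipschitz_grad.
apply: (@loc_lipschitz_comp _ _ (fun u => u^-1) (fun q => enorm (grad h q))).
  by apply: loc_lipschitz_inv; exact: enorm_gt0.
exact: loc_lipschitz_enorm_grad.
Qed.

Lemma loc_lipschitz_sfield p : grad f p != 0 -> grad g p != 0 ->
  loc_lipschitz (sfield f g zeta) p.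
Proof.
move=> fp gp; apply: loc_lipschitz_row => i.
rewrite (_ : (fun q => _) = (fun q =>
    - ((enorm (grad f q))^-1 * grad f q 0 i)
    + - (zeta * ((enorm (grad g q))^-1 * grad g q 0 i)))).
  apply: loc_lipschitzD; apply: loc_lipschitzN.
    exact: loc_lipschitz_normalized_grad.
  apply: loc_lipschitzM; first exact: loc_lipschitz_cst.
  exact: loc_lipschitz_normalized_grad.
by apply/funext => q; rewrite sfieldE.
Qed.

End sfield_theory.

(** * Cluster sets *)

(** Otherwise F would trace a proper filter on the complement of O, and by
    compactness that trace would have a cluster point outside O. *)
Lemma cluster_sub_open {T : topologicalType} (F : set_system T) (C O : set T) :
  ProperFilter F -> compact C -> F C -> open O -> cluster F `<=` O -> F O.
Proof.
move=> FF cC FC oO FO; apply: contrapT => nFO.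
have PG : ProperFilter (within (~` O) F).
  apply: Build_ProperFilter_ex => B FB; apply: contrapT => B0; apply: nFO.
  move: FB; rewrite /within/=; apply: filterS => x OB.
  by apply: contrapT => /OB Bx; apply: B0; exists x.
have [|p [_ Gp]] := cC _ PG; first by apply: filterS FC => x Cx _.
have Op : O p by apply: FO; apply: cvg_cluster Gp; exact: cvg_within.
have [//|//|q []//] := Gp (~` O) O.
- by rewrite /within/=; exact: filterE.
- exact: open_nbhs_nbhs.
Qed.

Lemma closed_cluster {T : topologicalType} (F : set_system T) :
  closed (cluster F).
Proof.
by rewrite clusterE; apply: closed_bigI => A _; exact: closed_closure.
Qed.

(** If the cluster set were a union of two nonempty separated parts, these
    would be closed, hence contained in disjoint open sets U and V. A connected
    member of F inside U `|` V lies in one of them, and then no cluster point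
    lies in the other. *)
Lemma connected_cluster {R : realType} {T : pseudoMetricType R}
    (F : set_system T) (C : set T) :
  ProperFilter F -> compact C -> F C ->
  (forall A, F A -> exists2 B, F B & B `<=` A /\ connected B) ->
  connected (cluster F).
Proof.
move=> FF cC FC Fconn; apply/connectedP => E [E0 KE [sep1 sep2]].
have clE b : closed (E b).
  move=> q qE; have : cluster F q.
    by apply: closed_cluster; apply: closureS qE; rewrite KE; case: b => ? ?;
      [right|left].
  rewrite KE; case: b qE => qE [] // Eq; exfalso.
    by have : (E false `&` closure (E true)) q by []; rewrite sep2.
  by have : (closure (E false) `&` E true) q by []; rewrite sep1.
have E01 : E false `&` E true = set0.
  by rewrite -subset0 -sep1; apply: setSI; exact: subset_closure.
have [U [V [oU oV EU EV UV]]] :=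
  (@normal_openP R T).1 pseudometric_normal _ _ (clE false) (clE true) E01.
have FUV : F (U `|` V).
  apply: (@cluster_sub_open _ _ C) => //; first exact: openU.
  by rewrite KE; exact: setUSS.
have sepUV : separated U V.
  split; apply/seteqP; split=> // q [].
    by move=> cU Vq; have := cU V (open_nbhs_nbhs (conj oV Vq));
      rewrite UV => -[].
  by move=> Uq cV; have := cV U (open_nbhs_nbhs (conj oU Uq));
    rewrite setIC UV => -[].
have [B FB [BUV cB]] := Fconn _ FUV.
have inK b q : E b q -> cluster F q by rewrite KE; case: b; [right|left].
have [BU|BV] := connected_subset sepUV BUV cB.
- have [q qE] := E0 true.
  have [z [Bz Vz]] := inK _ _ qE B V FB (open_nbhs_nbhs (conj oV (EV _ qE))).
  have UVz : (U `&` V) z by split=> //; exact: BU.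
  by rewrite UV in UVz.
- have [q qE] := E0 false.
  have [z [Bz Uz]] := inK _ _ qE B U FB (open_nbhs_nbhs (conj oU (EU _ qE))).
  have UVz : (U `&` V) z by split=> //; exact: BV.
  by rewrite UV in UVz.
Qed.

(** An isolated point of S contained in K is both open and closed in K. *)
Lemma connected_isolated_set1 {T : topologicalType} (K S : set T) (q : T) :
  hausdorff_space T -> connected K -> K q -> K `<=` S -> S `<=` isolated S ->
  K = [set q].
Proof.
move=> hT cK Kq KS /(_ _ (KS _ Kq)) [_ [V]].
rewrite nbhsE => -[W [oW Wq] WV] VS.
have KO : [set q] = K `&` W.
  apply/seteqP; split=> [z ->|z [Kz Wz]] //.
  by rewrite -VS; split; [exact: WV|exact: KS].
apply/esym; apply: cK; first by exists q.
- by exists W.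
- exists [set q]; first exact/accessible_closed_set1/hausdorff_accessible.
  by apply/seteqP; split=> [z ->|z []].
Qed.

Section left_of.
Context {R : realType}.
Implicit Type T : \bar R.

(** Lets the cases T finite and T infinite share the arguments that only
    involve times close to T. *)
Lemma left_ofP T (A : set R) : (0 < T)%E ->
  left_of T A <-> exists t0, [/\ 0 < t0, (t0%:E < T)%E &
    forall t, t0 <= t -> (t%:E < T)%E -> A t].
Proof.
case: T => [r| |] //=.
- rewrite lte_fin => r0; split.
    rewrite /at_left/within/= => /nbhs_ballP[e /= e0 H].
    exists (Num.max (r / 2) (r - e / 2)); split.
    + by rewrite lt_max divr_gt0.
    + by rewrite lte_fin gt_max; apply/andP; split; lra.
    + move=> t; rewrite ge_max lte_fin => /andP[t1 t2] tr; apply: H => //.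
      by rewrite -ball_normE/= gtr0_norm; lra.
  move=> [t0 [t00 t0r H]]; near=> t; apply: H.
    near: t; exact: nbhs_left_ge.
  by rewrite lte_fin; near: t; exact: nbhs_left_lt.
- move=> _; split.
    move=> [M [_ HM]]; exists (Num.max 1 (M + 1)); split.
    + by rewrite lt_max ltr01.
    + by rewrite ltry.
    + by move=> t; rewrite ge_max => /andP[_ t1] _; apply: HM; lra.
  move=> [t0 [t00 _ H]]; exists t0; split; first exact: num_real.
  by move=> t /ltW t0t; apply: H => //; rewrite ltry.
Unshelve. all: by end_near. Qed.

Lemma left_of_proper T : (0 < T)%E -> ProperFilter (left_of T).
Proof. by case: T => [r| |] //= _; exact: _. Qed.

End left_of.

(** The points at Euclidean distance less than e from some point of K form an
    open set containing K. *)
Lemma eucl_dist_cvg0 {R : realType} {n : nat} {I : Type} (G : set_system I)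
    (x : I -> 'rV[R]_n) (K : set 'rV[R]_n) : Filter G ->
  (forall O, open O -> K `<=` O -> \forall t \near G, O (x t)) ->
  eucl_dist (x t) K @[t --> G] --> (0 : R).
Proof.
move=> FG KO; apply/cvgrPdist_le => e e0.
pose O := \bigcup_(q in K) [set p : 'rV[R]_n | enorm (p - q) < e].
have oO : open O.
  apply: bigcup_open => q _.
  rewrite (_ : mkset _ = (fun p => enorm (p - q)) @^-1` [set u | u < e])//.
  apply: open_comp; last exact: open_lt.
  move=> p _; apply: (@continuous_comp _ _ _
    (fun p : 'rV[R]_n => p - q) (@enorm R n)).
    apply: (@lipschitz_continuous _ _ _ _ 1) => s t.
    by rewrite mul1r opprB addrA subrK.
  exact: enorm_continuous.
have KsubO : K `<=` O by move=> q Kq; exists q => //=; rewrite subrr enorm0.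
apply: filterS (KO _ oO KsubO) => t [q Kq /= tq].
have lb : lbound [set enorm (x t - q) | q in K] 0.
  by move=> _ [z _ <-]; exact: enorm_ge0.
have d0 : 0 <= eucl_dist (x t) K.
  by apply: lb_le_inf => //; exists (enorm (x t - q)); exists q.
rewrite sub0r normrN ger0_norm//; apply: le_trans (ltW tq).
by apply: ge_inf; [exists 0|exists q].
Qed.

(** * Extension of solutions *)

Lemma is_derive_shift {R : realType} {V : normedModType R} (z : R -> V)
    (c t : R) (d : V) :
  is_derive (t - c) (1 : R) z d -> is_derive t (1 : R) (fun u => z (u - c)) d.
Proof.
have E : (fun k : R => k^-1 *: (z (k *: 1 + t - c) - z (t - c))) =
         (fun k => k^-1 *: (z (k *: 1 + (t - c)) - z (t - c))).
  by apply/funext => k; rewrite addrA.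
move=> [dz zE].
by apply: DeriveDef; [rewrite /derivable/= E|rewrite /derive/= E].
Qed.

(** The mean value theorem between c and c + k identifies the difference
    quotient with a value of dy at a point between, which tends to l. *)
Lemma is_derive_of_limit {R : realType} (y dy : R -> R) (c l : R) :
  {for c, continuous y} ->
  (\forall t \near c, t != c -> is_derive t (1 : R) y (dy t)) ->
  (forall e, 0 < e -> \forall t \near c, t != c -> `|l - dy t| <= e) ->
  is_derive c (1 : R) y l.
Proof.
move=> yc dyE dyl.
suff H : (fun k : R => k^-1 *: (y (k *: 1 + c) - y c)) @ 0^' --> l.
  by apply: DeriveDef; [apply/cvg_ex; exists l|exact: cvg_lim].
apply/cvgrPdist_le => e e0.
have /nbhs_ballP[d /= d0 Hd] : \forall t \near c, t != c ->
    is_derive t (1 : R) y (dy t) /\ `|l - dy t| <= e.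
  near=> t => tc; split; move: tc; near: t; [exact: dyE|exact: dyl].
have {}Hd t : `|t - c| < d -> t != c ->
    is_derive t (1 : R) y (dy t) /\ `|l - dy t| <= e.
  by move=> td; apply: Hd; rewrite -ball_normE/= distrC.
have mv a b : a < b -> (a = c \/ b = c) -> `|a - c| < d -> `|b - c| < d ->
    `|l - (b - a)^-1 * (y b - y a)| <= e.
  move=> ab abc ad bd.
  have inab t : a <= t <= b -> `|t - c| < d.
    by move: ad bd; rewrite !ltr_norml; lra.
  have neqc t : a < t < b -> t != c.
    by case: abc => <- /andP[? ?]; [rewrite gt_eqF|rewrite lt_eqF].
  have D t : t \in `]a, b[ -> is_derive t (1 : R) y (dy t).
    rewrite in_itv/= => tab; have [] := Hd t => //; last exact: neqc.
    by apply: inab; move: tab => /andP[/ltW -> /ltW ->].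
  have C : {within `[a, b], continuous y}.
    apply: continuous_in_subspaceT => t; rewrite inE/= in_itv/= => tab.
    have [->//|tc] := eqVneq t c.
    have [dt _] := Hd t (inab _ tab) tc; exact: is_derive_continuous dt.
  have [s sab ->] := MVT ab D C.
  rewrite mulrC mulfK ?subr_eq0 ?gt_eqF//.
  rewrite in_itv/= in sab; have [|_] := Hd s _ (neqc _ sab) => //.
  by apply: inab; move: sab => /andP[/ltW -> /ltW ->].
near=> k.
have k0 : k != 0 by near: k; exact: nbhs_dnbhs_neq.
have kd : `|k| < d.
  by near: k; exact: dnbhs0_lt.
rewrite /GRing.scale/= mulr1.
have [kgt|kle] := ltP 0 k.
  have := mv c (k + c); rewrite addrK subrr normr0; apply => //; [lra|by left].
have klt : k < 0 by rewrite lt_neqAle k0.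
have -> : k^-1 * (y (k + c) - y c) = (c - (k + c))^-1 * (y c - y (k + c)).
  by rewrite opprD addrCA subrr addr0 invrN mulNr -mulrN opprB.
by apply: mv; rewrite ?addrK ?subrr ?normr0//; [lra|right].
Unshelve. all: by end_near. Qed.

(** A solution on the left of T that converges to p at T is continued by the
    Picard-Lindelof solution issued from p. At the junction T itself, the
    derivative exists because F (y t) is continuous there
    ([is_derive_of_limit]). *)
Lemma solution_extends {R : realType} {n : nat} (F : 'rV[R]_n -> 'rV[R]_n)
    (x : R -> 'rV[R]_n) (p : 'rV[R]_n) (T s : R) : 0 < s ->
  loc_lipschitz F p -> x t @[t --> T^'-] --> p ->
  (\forall t \near T^'-, is_derive t (1 : R) x (F (x t))) ->
  exists2 e, 0 < e & exists2 y : R -> 'rV[R]_n, (forall t, t < T -> y t = x t) &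
    forall t, T <= t < T + e ->
      `|y t - p| <= s /\ is_derive t (1 : R) y (F (y t)).
Proof.
move=> s0 Fl xp dx; have [L [B [r [L0 _ r0 FL]]]] := loc_lipschitz_bound _ _ Fl.
pose r' := Num.min r s.
have r'0 : 0 < r' by rewrite lt_min r0.
have [|e e0 [z z0 dz]] := @picard_lindelof _ _ F p r' L r'0 L0.
  by move=> q q' qr q'r; have [] := FL r' _ q q' => //; rewrite ge_min lexx.
exists e => //; exists (fun t => if t < T then x t else z (t - T)) => [t ->//|].
set y := fun t => _.
have yT : y T = p by rewrite /y ltxx subrr.
have dy_gt t : T < t < T + e -> is_derive t (1 : R) y (F (y t)).
  move=> /andP[Tt te]; have tT : `|t - T| < e by rewrite ltr_norml; lra.
  have yz : \forall u \near t, z (u - T) = y u.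
    near=> u; rewrite /y ifN// -leNgt ltW//; near: u; exact: lt_nbhsr.
  apply: (near_eq_is_derive yz); rewrite -(nbhs_singleton yz).
  by apply: is_derive_shift; have [] := dz _ tT.
have dy_lt : \forall t \near T, t < T -> is_derive t (1 : R) y (F (y t)).
  near=> t => tT.
  have yx : \forall u \near t, x u = y u.
    near=> u; rewrite /y ifT//; near: u; exact: lt_nbhsl.
  apply: (near_eq_is_derive yx); rewrite -(nbhs_singleton yx).
  by move: tT; near: t; exact: dx.
have yc : {for T, continuous y}.
  apply/cvgrPdist_le => d d0.
  have zc : {for 0, continuous z}.
    by have [] := dz 0; [rewrite normr0|move=> _; exact: is_derive_continuous].
  have Hz : \forall t \near T, `|p - z (t - T)| <= d.
    have /cvgrPdist_le/(_ d d0) := zc; rewrite z0 => /nbhs_ballP[a a0 H].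
    apply/nbhs_ballP; exists a => // t; rewrite -ball_normE/= distrC => tT.
    by apply: H; rewrite -ball_normE/= sub0r normrN.
  have Hx : \forall t \near T, t < T -> `|p - x t| <= d.
    by have /cvgrPdist_le/(_ d d0) := xp.
  rewrite yT; near=> t; rewrite /y; case: ifPn => [tT|_].
    by move: tT; near: t; exact: Hx.
  by near: t; exact: Hz.
have Fyc : {for T, continuous (F \o y)}.
  apply: continuous_comp => //; rewrite yT.
  exact: loc_lipschitz_continuous.
have near_e : \forall t \near T, t < T + e by apply: lt_nbhsl; lra.
have dyE : \forall t \near T, t != T -> is_derive t (1 : R) y (F (y t)).
  near=> t; rewrite neq_lt => /orP[tT|tT].
    by move: tT; near: t; exact: dy_lt.
  by apply: dy_gt; rewrite tT/=; near: t.
move=> t /andP[Tt te]; have tT : `|t - T| < e by rewrite ltr_norml; lra.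
split.
  rewrite /y ltNge Tt/=; have [H _] := dz _ tT.
  by apply: le_trans H _; rewrite ge_min lexx orbT.
move: Tt; rewrite le_eqVlt => /predU1P[<-|Tt]; last by apply: dy_gt; rewrite Tt.
apply/is_derive_rowP => i.
apply: (@is_derive_of_limit _ _ (fun u => F (y u) 0 i)).
- by apply: (@continuous_comp _ _ _ y (fun v : 'rV[R]_n => v 0 i)) => //;
  exact: coord_continuous.
- by apply: filterS dyE => u H /H /is_derive_rowP.
- move=> d d0; have /cvgrPdist_le/(_ d d0) := Fyc; apply: filterS => u H _.
  by apply: le_trans H; have := row_coord_le (F (y T) - F (y u)) i;
    rewrite !mxE.
Unshelve. all: by end_near. Qed.

(** * Trajectories of s_zeta *)

Lemma is_derive_along {R : realType} {n : nat} (f : 'rV[R]_n -> R)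
    (x : R -> 'rV[R]_n) (t : R) (d : 'rV[R]_n) :
  differentiable f (x t) -> is_derive t (1 : R) x d ->
  is_derive t (1 : R) (f \o x) (\sum_i d 0 i * grad f (x t) 0 i).
Proof.
move=> df [dx xd]; have dx' : differentiable x t by apply/derivable1_diffP.
have dfx : differentiable (f \o x) t by exact: differentiable_comp.
apply: DeriveDef; first exact/derivable1_diffP.
by rewrite deriveE// diff_comp//= -[X in 'd f _ X]deriveE// xd -deriveE//
  derive_grad.
Qed.

Lemma grad_neq0_near {R : realType} {n : nat} (f : 'rV[R]_n -> R)
    (p : 'rV[R]_n) : cont_diff2 f -> grad f p != 0 ->
  exists c r, [/\ 0 < c, 0 < r &
    forall q, `|q - p| <= r -> c <= enorm (grad f q)].
Proof.
move=> f2 fp; have e0 := enorm_gt0 _ fp.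
have /loc_lipschitz_continuous/cvgrPdist_le :=
  loc_lipschitz_enorm_grad f p f2 fp.
move=> /(_ (enorm (grad f p) / 2) ltac:(lra))/nbhs_ballP[r /= r0 H].
exists (enorm (grad f p) / 2), (r / 2); split; try lra.
move=> q qp.
have : `|enorm (grad f p) - enorm (grad f q)| <= enorm (grad f p) / 2.
  by apply: H; rewrite -ball_normE/= distrC; lra.
by rewrite ler_norml; lra.
Qed.

Section trajectory.
Context {R : realType} {n : nat} {f g : 'rV[R]_n -> R} {zeta : R}.
Context {x0 : 'rV[R]_n} {T : \bar R} {x : R -> 'rV[R]_n}.
Hypothesis A4f : cont_diff2 f.
Hypotheses (zeta_ge0 : 0 <= zeta) (zeta_lt1 : zeta < 1).
Hypothesis x_sol : is_solution f g zeta x0 T x.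

Let T_gt0 : (0 < T)%E. Proof. by case: x_sol. Qed.

Let dx t : 0 < t -> (t%:E < T)%E ->
  is_derive t (1 : R) x (sfield f g zeta (x t)).
Proof. by move=> t0 tT; case: x_sol => _ _ _ _; exact. Qed.

Let zeta_subr_gt0 : 0 < 1 - zeta. Proof. by rewrite subr_gt0. Qed.

Let zeta01 : 0 <= zeta <= 1. Proof. by rewrite zeta_ge0 ltW. Qed.

Lemma trajectory_lipschitz s t : 0 < s -> s <= t -> (t%:E < T)%E ->
  `|x t - x s| <= 2 * (t - s).
Proof.
move=> s0 st tT.
apply: (@mean_value_norm_le _ _ x (fun u => sfield f g zeta (x u))) => // u
  /andP[su ut].
  by apply: dx; [lra|apply: le_lt_trans tT; rewrite lee_fin].
exact: norm_sfield_le.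
Qed.

Lemma trajectory_descent (c s t : R) : 0 < s -> s <= t -> (t%:E < T)%E ->
  (forall u, s <= u <= t -> c <= enorm (grad f (x u))) ->
  f (x t) <= f (x s) - (1 - zeta) * c * (t - s).
Proof.
move=> s0 st tT cu.
have D u : s <= u <= t -> is_derive u (1 : R) (f \o x)
    (\sum_i sfield f g zeta (x u) 0 i * grad f (x u) 0 i).
  move=> /andP[su ut]; apply: is_derive_along; first exact: A4f.1.1.
  by apply: dx; [lra|apply: le_lt_trans tT; rewrite lee_fin].
suff : (f \o x) t - (f \o x) s <= - ((1 - zeta) * c) * (t - s)
  by rewrite /=; lra.
apply: (@mean_value_le _ _
  (fun u => \sum_i sfield f g zeta (x u) 0 i * grad f (x u) 0 i)) => //.
- by move=> u /andP[/ltW su /ltW ut]; apply: D; rewrite su ut.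
- by apply: derivable_within_continuous => u; rewrite in_itv/= => /D[].
- move=> u /andP[/ltW su /ltW ut].
  have uT : (u%:E < T)%E by apply: le_lt_trans tT; rewrite lee_fin.
  have u0 : 0 <= u by lra.
  case: x_sol => _ _ /(_ u u0 uT)[fu gu] _ _.
  apply: le_trans (sfield_descent _ zeta_ge0 fu gu) _.
  by rewrite lerN2; apply: ler_wpM2l; [exact: ltW|apply: cu; rewrite su ut].
Qed.

Lemma trajectory_noninc s t : 0 < s -> s <= t -> (t%:E < T)%E ->
  f (x t) <= f (x s).
Proof.
move=> s0 st tT; have := @trajectory_descent 0 s t s0 st tT.
by rewrite mulr0 mul0r subr0; apply => u _; exact: enorm_ge0.
Qed.

Let F := x @ left_of T.

Let FF : ProperFilter F.
Proof. by have := left_of_proper T T_gt0 => ?; exact: fmap_proper_filter. Qed.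

Lemma trajectory_precompact : coercive f -> exists2 C, compact C & F C.
Proof.
move=> A1.
have [s [s0 sT _]] : exists t0, [/\ 0 < t0, (t0%:E < T)%E &
    forall t, t0 <= t -> (t%:E < T)%E -> True].
  by apply/(left_ofP T setT T_gt0); have := left_of_proper T T_gt0 => ?;
    exact: filterT.
have [r Hr] := A1 (f (x s)).
exists [set q | `|q| <= r].
  apply: bounded_closed_compact.
    exists r; split; first exact: num_real.
    by move=> M rM q /= qr; apply: le_trans qr _; exact: ltW.
  rewrite (_ : mkset _ = Num.norm @^-1` [set u | u <= r])//.
  by apply: closed_comp; [move=> q _; exact: norm_continuous|exact: closed_le].
apply/left_ofP => //; exists s; split=> // t st tT /=.
apply: le_trans (norm_le_enorm _) _; rewrite leNgt; apply/negP => /Hr.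
by rewrite ltNge trajectory_noninc.
Qed.

(** f is nonincreasing along the trajectory, so its value at a limit point is
    a lower bound. *)
Lemma cluster_le_trajectory p s : cluster F p -> 0 < s -> (s%:E < T)%E ->
  f p <= f (x s).
Proof.
move=> Fp s0 sT; rewrite leNgt; apply/negP => fps.
have Fs : F [set x t | t in [set t | s <= t /\ (t%:E < T)%E]].
  by apply/left_ofP => //; exists s; split=> // t st tT; exists t.
have Os : nbhs p [set q | f (x s) < f q].
  have fc : {for p, continuous f} := differentiable_continuous (A4f.1.1 p).
  by have /cvgr_gt := fc; apply.
have [_ [[t [st tT] <-] /=]] := Fp _ _ Fs Os.
by rewrite ltNge trajectory_noninc.
Qed.

Lemma cluster_approx p t1 e : cluster F p -> 0 < t1 -> (t1%:E < T)%E -> 0 < e ->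
  exists t, [/\ t1 <= t, (t%:E < T)%E & `|x t - p| < e].
Proof.
move=> Fp t10 t1T e0.
have Fs : F [set x t | t in [set t | t1 <= t /\ (t%:E < T)%E]].
  by apply/left_ofP => //; exists t1; split=> // t st tT; exists t.
have [_ [[t [st tT] <-]]] := Fp _ _ Fs (nbhsx_ballx p e e0).
by rewrite -ball_normE/= distrC; exists t.
Qed.

Lemma connected_omega_limit : coercive f -> connected (cluster F).
Proof.
move=> /trajectory_precompact[C cC FC];
  apply: (connected_cluster F C) => // A FA.
have [t0 [t00 t0T HA]] := (left_ofP T _ T_gt0).1 FA.
pose I := [set t | t0 <= t /\ (t%:E < T)%E].
exists (x @` I).
  by apply/left_ofP => //; exists t0; split=> // t st tT; exists t.
split; first by move=> _ [t [t0t tT] <-]; exact: HA.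
apply: connected_continuous_connected.
  apply/connected_intervalP => a b [t0a aT] [t0b bT] c /andP[ac cb].
  by split; [exact: le_trans ac|apply: le_lt_trans bT; rewrite lee_fin].
apply: continuous_in_subspaceT => t; rewrite inE => -[t0t tT].
by apply: is_derive_continuous; apply: dx => //; exact: lt_le_trans t0t.
Qed.

(** With |grad f| >= c on the ball of radius r around p, a visit within r / 2
    of p is followed by a stay of duration h = r / 4 in that ball, because the
    speed is at most 2. During it f drops by at least (1 - zeta) c h, which a
    visit close enough to p makes incompatible with f >= f p. *)
Lemma omega_limit_crit_infinite : T = +oo%E -> cluster F `<=` crit f.
Proof.
move=> Too p Fp; apply/eqP/negPn/negP => fp.
have [c [r [c0 r0 cr]]] := grad_neq0_near _ _ A4f fp.
have ltT t : (t%:E < T)%E by rewrite Too ltry.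
pose h := r / 4; have h0 : 0 < h by rewrite /h; lra.
have fc : {for p, continuous f} := differentiable_continuous (A4f.1.1 p).
have g0 : 0 < (1 - zeta) * c * h by rewrite !mulr_gt0.
have /cvgrPdist_lt/(_ _ g0)/nbhs_ballP[d /= d0 Hd] := fc.
have m0 : 0 < Num.min d (r / 2) by rewrite lt_min d0; lra.
have [t [t1 _]] := cluster_approx _ _ _ Fp ltr01 (ltT 1) m0.
rewrite lt_min => /andP[td tr].
have ft : f (x t) < f p + (1 - zeta) * c * h.
  have := Hd (x t); rewrite -ball_normE/= distrC => /(_ td).
  by rewrite ltr_norml; lra.
have : f (x (t + h)) <= f (x t) - (1 - zeta) * c * (t + h - t).
  apply: trajectory_descent => //; [lra|lra|move=> u /andP[tu uh]; apply: cr].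
  have H := @trajectory_lipschitz t u ltac:(lra) tu (ltT u).
  rewrite -(subrKA (x t)); apply: le_trans (ler_normD _ _) _.
  by move: H uh tr; rewrite /h; lra.
have := @cluster_le_trajectory p (t + h) Fp ltac:(lra) (ltT _).
rewrite [t + h]addrC addrK; lra.
Qed.

(** The speed is at most 2 and the remaining time tends to 0, so a single late
    visit near p keeps the trajectory near p until T. *)
Lemma cluster_finite_time (r : R) p : T = r%:E -> cluster F p -> F --> p.
Proof.
move=> Tr Fp; have PT := left_of_proper T T_gt0.
apply/cvgrPdist_le => e e0.
have r0 : 0 < r by rewrite -lte_fin -Tr.
have r2 : 0 < r / 2 by rewrite divr_gt0.
(* t1 is positive, and the time left after t1 is at most e / 4. *)
pose t1 := Num.max (r / 2) (r - e / 4).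
have t10 : 0 < t1 by rewrite lt_max r2.
have t1r : t1 < r by rewrite gt_max; apply/andP; split; lra.
have t1T : (t1%:E < T)%E by rewrite Tr lte_fin.
have [s [t1s sT spe]] := cluster_approx p t1 (e / 2) Fp t10 t1T ltac:(lra).
have s0 : 0 < s by exact: lt_le_trans t1s.
apply/left_ofP => //; exists s; split=> // t st tT /=.
have tr : t < r by rewrite Tr lte_fin in tT.
have se : r - e / 4 <= s by apply: le_trans t1s; rewrite le_max lexx orbT.
have := trajectory_lipschitz s t s0 st tT => H.
rewrite distrC -(subrKA (x s)); apply: le_trans (ler_normD _ _) _; lra.
Qed.

End trajectory.

(** Otherwise [solution_extends] produces a solution on a longer interval; the
    radius s keeps the extension where grad f does not vanish. *)
Lemma maximal_limit_crit {R : realType} {n : nat} {f g : 'rV[R]_n -> R}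
    {zeta r : R} {x0 p : 'rV[R]_n} {x : R -> 'rV[R]_n} :
  cont_diff2 f -> cont_diff2 g -> (forall q, grad g q != 0) ->
  is_max_solution f g zeta x0 r%:E x -> x t @[t --> r^'-] --> p -> crit f p.
Proof.
move=> f2 g2 g0 [[T0 x00 xn0 x0d dx] xmax] xp; apply/eqP/negPn/negP => fp.
rewrite lte_fin in T0.
have [c [s [c0 s0 cs]]] := grad_neq0_near _ _ f2 fp.
have dxl : \forall t \near r^'-, is_derive t (1 : R) x (sfield f g zeta (x t)).
  near=> t; apply: dx.
    near: t; exact: nbhs_left_gt.
  by rewrite lte_fin; near: t; exact: nbhs_left_lt.
have [e e0 [y yx dy]] := @solution_extends _ _ (sfield f g zeta) x p r s s0
  (loc_lipschitz_sfield f2 g2 p fp (g0 p)) xp dxl.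
suff : (r + e)%:E = r%:E.
  by move=> [] /eqP; rewrite -subr_eq0 addrAC subrr add0r gt_eqF.
apply: (xmax _ y) => [||t _].
2: by rewrite lee_fin; lra.
2: by rewrite lte_fin => /yx.
split.
- by rewrite lte_fin; lra.
- by rewrite yx.
- move=> t t0; rewrite lte_fin => te; split; last exact: g0.
  have [tr|rt] := ltP t r; first by rewrite yx//;
    have [] := xn0 t t0 ltac:(by rewrite lte_fin).
  have [yp _] := dy t ltac:(by rewrite rt).
  apply/eqP => y0; have := cs _ yp; rewrite y0 enorm0; lra.
- rewrite (yx 0)//; apply: cvg_trans x0d; apply: near_eq_cvg.
  near=> h; rewrite yx//; near: h; exact: nbhs_right_lt.
- move=> t t0; rewrite lte_fin => te.
  have [tr|rt] := ltP t r; last by have [] := dy t ltac:(by rewrite rt).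
  have yxn : \forall u \near t, x u = y u.
    by near=> u; rewrite yx//; near: u; exact: lt_nbhsl.
  by apply: (near_eq_is_derive yxn); rewrite yx//; apply: dx; rewrite ?lte_fin.
Unshelve. all: by end_near. Qed.

Theorem theorem2 (R : realType) (n : nat) (f g : 'rV[R]_n -> R)
    (A1 : coercive f)
    (A4f : cont_diff2 f) (A4g : cont_diff2 g)
    (gradg_neq0 : forall p : 'rV[R]_n, grad g p != 0)
    (x0 : 'rV[R]_n) (x0_feasible : feasible g x0) (gradf_x0 : grad f x0 != 0)
    (zeta : R) (zeta_ge0 : 0 <= zeta) (zeta_lt1 : zeta < 1)
    (T : \bar R) (x : R -> 'rV[R]_n)
    (x_sol : is_max_solution f g zeta x0 T x) :
  (exists K : set 'rV[R]_n,
     [/\ K !=set0, connected K, K `<=` crit f &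
         eucl_dist (x t) K @[t --> left_of T] --> (0 : R)]) /\
  (crit f `<=` isolated (crit f) ->
   exists2 xc : 'rV[R]_n, crit f xc & x t @[t --> left_of T] --> xc).
Proof.
have sol := x_sol.1.
have T0 : (0 < T)%E by case: sol.
have PT := left_of_proper T T0.
pose K := cluster (x @ left_of T).
have [C cC FC] := trajectory_precompact A4f zeta_ge0 zeta_lt1 sol A1.
have K0 : K !=set0 by have [p [_ Kp]] := cC _ _ FC; exists p.
have Kc : connected K.
  exact: (connected_omega_limit A4f zeta_ge0 zeta_lt1 sol A1).
have Kcrit : K `<=` crit f.
  case: T x_sol sol T0 @K {PT FC K0 Kc} => [r| |] x_sol sol T0 K //.
    move=> p Kp.
    have xp := cluster_finite_time zeta_ge0 zeta_lt1 sol r p erefl Kp.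
    exact: (maximal_limit_crit A4f A4g gradg_neq0 x_sol xp).
  exact: (omega_limit_crit_infinite A4f zeta_ge0 zeta_lt1 sol).
have KO (O : set 'rV[R]_n) : open O -> K `<=` O ->
    \forall t \near left_of T, O (x t).
  by move=> oO KO; apply: (cluster_sub_open (x @ left_of T) C O).
split; first by exists K; split=> //; exact: eucl_dist_cvg0.
move=> iso; have [p Kp] := K0; exists p; first exact: Kcrit.
have Kp1 : K = [set p].
  by apply: (connected_isolated_set1 K (crit f) p _ Kc Kp Kcrit iso);
    exact: norm_hausdorff.
move=> U; rewrite nbhsE => -[W [oW Wp] WU].
by apply: filterS (KO W oW _) => [t /WU//|]; rewrite Kp1 => _ ->.
Qed.
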